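(* Let $(X,Y)$ be a pair of real-valued random variables with a joint density, and let $K\ge1$ be such that $I(X;Y)\le\log K$, i.e. $h(X,Y)\geq h(X)+h(Y)-\log K$, and $$h(X+Y)\leq\tfrac12h(X)+\tfrac12h(Y)+\log K.$$ Let $(X_2,Y,X_1,Y')$ be random variables forming a Markov chain $X_2 - Y - X_1 - Y'$ (i.e. $X_1,X_2$ are conditionally independent given $Y$, and $Y'$ is conditionally independent of $(X_2,Y)$ given $X_1$), such that each of the pairs $(X_2,Y)$, $(X_1,Y)$ and $(X_1,Y')$ has the same joint distribution as $(X,Y)$. Then $$h(X_2\mid X_1,Y)\geq h(X)-\log K,$$ $$h(Y'\mid X_1,Y)\geq h(Y)-\log K,$$ $$h(X_2+Y'\mid X_1,Y)\leq\tfrac12h(X)+\tfrac12h(Y)+7\log K.$$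
   Context: Standing conventions: random variables are real-valued with densities (vectors have joint densities), all (conditional) differential entropies $h$ appearing exist and are finite. $I(U;V)=h(U)+h(V)-h(U,V)$; $\log$ is the natural logarithm. *)

(* Defs.v *)
From HB Require Import structures.
From mathcomp Require Import all_boot all_order all_algebra.
From mathcomp Require Import all_classical all_reals all_analysis.
Set Implicit Arguments. Unset Strict Implicit. Unset Printing Implicit Defensive.
Import Order.TTheory GRing.Theory Num.Theory.
Local Open Scope classical_set_scope.
Local Open Scope ring_scope.

Definition leb1 (R : realType) : set R -> \bar R := @lebesgue_measure R.
Definition leb2 (R : realType) : set (R * R) -> \bar R :=
  (@lebesgue_measure R \x @lebesgue_measure R)%E.
Definition leb3 (R : realType) : set ((R * R) * R) -> \bar R :=
  ((@lebesgue_measure R \x @lebesgue_measure R) \x @lebesgue_measure R)%E.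

Section defs.
Context {d dV : measure_display} {T : measurableType d} {V : measurableType dV}
  {R : realType}.

Definition is_density (mu : set V -> \bar R) (P : probability T R)
    (Z : T -> V) (f : V -> R) : Prop :=
  measurable_fun setT f /\ (forall x, 0 <= f x) /\
  forall A, measurable A -> P (Z @^-1` A) = (\int[mu]_(x in A) (f x)%:E)%E.

Definition has_entropy (mu : set V -> \bar R) (P : probability T R)
    (Z : T -> V) : Prop :=
  exists f, is_density mu P Z f /\
    mu.-integrable setT (fun x => (f x * ln (f x))%:E).

(* a density of Z (chosen; any two agree mu-a.e.) *)
Definition density_of (mu : set V -> \bar R) (P : probability T R)
    (Z : T -> V) : V -> R :=
  xget (fun _ => 0) (is_density mu P Z).

Definition dentropy (mu : set V -> \bar R) (P : probability T R)
    (Z : T -> V) : R :=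
  let f := density_of mu P Z in
  - fine (\int[mu]_x (f x * ln (f x))%:E)%E.
End defs.

Section condindep.
Context {d dU dV dW : measure_display} {T : measurableType d}
  {U : measurableType dU} {V : measurableType dV} {W : measurableType dW}
  {R : realType}.

(* B is conditionally independent of A given C: the conditional law of B
   given (A, C) can be chosen as a probability kernel depending on C only. *)
Definition cond_indep (P : probability T R) (A : T -> U) (B : T -> V)
    (C : T -> W) : Prop :=
  exists k : R.-pker W ~> V,
    forall SA SB SC, measurable SA -> measurable SB -> measurable SC ->
      P (A @^-1` SA `&` B @^-1` SB `&` C @^-1` SC) =
      (\int[P]_(t in A @^-1` SA `&` C @^-1` SC) k (C t) SB)%E.
End condindep.

Definition pairRV {T U V : Type} (A : T -> U) (B : T -> V) : T -> U * V :=
  fun t => (A t, B t).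

(* Main.v *)
(* By the Markov property, (X2, Y, X1, Y') has the explicit density
   p = f(x2,y) f(x1,y) f(x1,y') / (fY(y) fX(x1)), f being the density of (X,Y);
   this computes h(X2|X1,Y) = h(X|Y) and h(Y'|X1,Y) = h(Y|X).

   For the third inequality put S = X2 + Y' and use
   S = (X2 + Y) - (X1 + Y) + (X1 + Y').  With m, w, rho, r and g the densities
   of (S,X2), (X2+Y,X1+Y,S), S, (X1,Y,S) and X+Y, the ratio
     fX(X2) fY(Y') g(X2+Y) g(X1+Y) g(X1+Y') f(X1,Y) / (p r)
   is the product of the four ratios
     fX fY / m,   g g g / w,   w (m / rho) / p,   f rho / r,
   each of expectation at most 1.  Since ln u <= u - 1, the expectation of its
   logarithm is at most 0.  That logarithm only involves densities with finite
   entropy, so nothing has to be assumed about the entropies of m, w and rho.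
   The outcome is h(S|X1,Y) <= 2h(X) + 2h(Y) + 3h(X+Y) - 3h(X,Y), which gives
   the bound with constant 6 in place of 7. *)
Require Import Defs.
From HB Require Import structures.
From mathcomp Require Import all_boot all_order all_algebra.
From mathcomp Require Import all_classical all_reals all_analysis.
From mathcomp Require Import measurable_realfun ring lra.
Import Order.TTheory GRing.Theory Num.Theory.
Local Open Scope classical_set_scope.
Local Open Scope ring_scope.

Set Implicit Arguments.
Unset Strict Implicit.
Unset Printing Implicit Defensive.

(** * Product measures as sigma-finite measures *)

Section product_sigma_finite.
Context {d1 d2 : measure_display} {V1 : measurableType d1}
  {V2 : measurableType d2} {R : realType}.
Variables (m1 : {sigma_finite_measure set V1 -> \bar R})
  (m2 : {sigma_finite_measure set V2 -> \bar R}).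

(* A copy of the product measure: the canonical sigma-finite structure that the
   library attaches to [\x] only applies to products of subprobabilities. *)
Definition prod_measure : set (V1 * V2) -> \bar R := (m1 \x m2)%E.

HB.instance Definition _ := isMeasure.Build _ (V1 * V2)%type R prod_measure
  (measure0 (m1 \x m2)%E) (measure_ge0 (m1 \x m2)%E)
  (@measure_semi_sigma_additive _ _ _ (m1 \x m2)%E).

Let prod_measure_sigma_finite : sigma_finite setT prod_measure.
Proof.
have /sigma_finiteP[F [TF ndF mF]] := sigma_finiteT m1.
have /sigma_finiteP[G [TG ndG mG]] := sigma_finiteT m2.
exists (fun n => F n `*` G n).
  apply/seteqP; split=> // -[x y] _.
  have [i _ Fix] : (\bigcup_i F i) x by rewrite -TF.
  have [j _ Gjy] : (\bigcup_j G j) y by rewrite -TG.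
  (* Both exhaustions are nondecreasing, so the later index covers both coordinates. *)
  exists (maxn i j) => //; split => /=.
    by move: x Fix; exact/subsetPset/ndF/leq_maxl.
  by move: y Gjy; exact/subsetPset/ndG/leq_maxr.
move=> n; have [mFn Fn] := mF n; have [mGn Gn] := mG n.
split; first exact: measurableX.
rewrite /prod_measure product_measure1E//.
by rewrite lte_mul_pinfty// ge0_fin_numE.
Qed.

HB.instance Definition _ := Measure_isSigmaFinite.Build _ (V1 * V2)%type R
  prod_measure prod_measure_sigma_finite.

End product_sigma_finite.

Local Notation "m1 \X m2" := (prod_measure m1 m2)
  (at level 40, left associativity).

(** * Lebesgue measure on the line, the plane and space *)

Section lebesgue_measures.
Context {R : realType}.
Local Notation lebR := (@lebesgue_measure R).

HB.instance Definition _ := isMeasure.Build _ R R (@leb1 R)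
  (measure0 lebR) (measure_ge0 lebR) (@measure_semi_sigma_additive _ _ _ lebR).

HB.instance Definition _ := isMeasure.Build _ (R * R)%type R (@leb2 R)
  (measure0 (lebR \x lebR)%E) (measure_ge0 (lebR \x lebR)%E)
  (@measure_semi_sigma_additive _ _ _ (lebR \x lebR)%E).

Let leb12 := prod_measure lebR lebR.

HB.instance Definition _ := isMeasure.Build _ (R * R * R)%type R (@leb3 R)
  (measure0 (prod_measure leb12 lebR)) (measure_ge0 (prod_measure leb12 lebR))
  (@measure_semi_sigma_additive _ _ _ (prod_measure leb12 lebR)).

HB.instance Definition _ := Measure_isSigmaFinite.Build _ R R (@leb1 R)
  (@sigma_finiteT _ _ _ lebR).

(** Passes from the reference measure of the statement to a product of sigma-finite copies [leb1],
    to which sections, marginals and Tonelli apply. Both measures are determined by their values on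
    rectangles. *)
Lemma leb2E (A : set (R * R)) : measurable A ->
  leb2 A = prod_measure (@leb1 R) (@leb1 R) A.
Proof.
move=> mA; apply/esym; apply: (product_measure_unique (m' := @leb2 R)) => //.
move=> B C mB mC; exact: (@product_measure1E _ _ _ _ _ lebR lebR).
Qed.

Lemma leb3E (A : set (R * R * R)) : measurable A ->
  leb3 A = prod_measure (prod_measure (@leb1 R) (@leb1 R)) (@leb1 R) A.
Proof.
move=> mA; apply/esym; apply: (product_measure_unique (m' := @leb3 R)) => //.
move=> B C mB mC; rewrite -[X in (X * _)%E](leb2E mB).
exact: (@product_measure1E _ _ _ _ _ leb12 lebR).
Qed.

(** Lebesgue measure is determined by its values on half-open intervals, whose length a translation
    preserves. *)
Lemma leb1_shift (c : R) (A : set R) : measurable A ->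
  leb1 ((fun x => x + c) @^-1` A) = leb1 A.
Proof.
move=> mA; apply/esym.
pose f : measurableTypeR R -> measurableTypeR R := fun x => x + c.
have mf : measurable_fun setT f.
  have : measurable_fun setT (fun x : R => x + c) by apply: measurable_funD.
  by [].
apply: (lebesgue_measure_unique (mu := pushforward lebR f)) => //.
move=> _ [[a b] _ <-].
rewrite /pushforward; transitivity (lebR `]a - c, b - c]%classic).
  rewrite !lebesgue_measure_itv/= !lte_fin ltrD2r.
  by case: ifPn => // _; rewrite -!EFinB opprB addrA subrK.
congr (lebR _); apply/seteqP.
by split=> x /=; rewrite !in_itv/= ltrBlDr lerBrDr.
Qed.

End lebesgue_measures.

(** Inversion is continuous off 0; the point 0 is split off as a measurable singleton. *)
Lemma measurable_invr (R : realType) : measurable_fun setT (@GRing.inv R).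
Proof.
rewrite (_ : setT = [set 0] `|` ~` [set 0]); last by rewrite setUv.
apply/measurable_funU => //; first exact: measurableC.
split; first exact: measurable_fun_set1.
apply: open_continuous_measurable_fun; first exact/closed_openC/closed_eq.
by move=> x /[!inE] x0; apply: inv_continuous; exact/eqP.
Qed.

(** * Densities, expectations and entropy *)

Section density_integral.
Import HBNNSimple.
Local Open Scope ereal_scope.
Context {d : measure_display} {V : measurableType d} {R : realType}.
Variables (mu nu : {measure set V -> \bar R}) (f : V -> R).
Hypotheses (mf : measurable_fun setT f) (f0 : forall x, (0 <= f x)%R).
Hypothesis nuE : forall A, measurable A -> nu A = \int[mu]_(x in A) (f x)%:E.

(** The hypothesis [nuE] is the case of indicators; linearity gives simple functions, and monotone
    convergence gives all nonnegative measurable ones. *)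
Lemma ge0_integral_density (phi : V -> \bar R) :
  measurable_fun setT phi -> (forall x, 0 <= phi x) ->
  \int[nu]_x phi x = \int[mu]_x (phi x * (f x)%:E).
Proof.
move=> mphi phi0.
pose h := nnsfun_approx measurableT mphi.
have mEf : measurable_fun setT (EFin \o f) by exact/measurable_EFinP.
have phiE x : phi x = limn (fun n => (h n x)%:E).
  by apply/esym/cvg_lim => //; exact: cvg_nnsfun_approx.
transitivity (limn (fun n => \int[nu]_x (h n x)%:E)).
  under eq_integral do rewrite phiE.
  apply: monotone_convergence => //.
  - by move=> n; exact/measurable_EFinP.
  - by move=> n x _; rewrite lee_fin.
  - by move=> x _ m n mn; rewrite lee_fin; exact/lefP/nd_nnsfun_approx.
transitivity (limn (fun n => \int[mu]_x ((h n x)%:E * (f x)%:E))); last first.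
  rewrite -monotone_convergence//.
  - apply: eq_integral => x _; apply/cvg_lim => //.
    by apply: cvgeZr => //; exact: cvg_nnsfun_approx.
  - by move=> n; apply: emeasurable_funM => //; exact/measurable_EFinP.
  - by move=> n x _; rewrite mule_ge0// lee_fin.
  - move=> x _ m n mn; rewrite lee_wpmul2r ?lee_fin//.
    exact/lefP/nd_nnsfun_approx.
congr (limn _); apply/funext => n.
have hE x : (h n x)%:E =
    \sum_(y \in range (h n)) (y * \1_(h n @^-1` [set y]) x)%:E.
  by rewrite fsumEFin// -fimfunE.
under eq_integral do rewrite hE.
under [RHS]eq_integral => x _.
  rewrite hE ge0_mule_fsuml; last by move=> y; exact: nnfun_muleindic_ge0.
  over.
rewrite !ge0_integral_fsum//.
- apply: eq_fsbigr => y /[!inE] -[t _ <-].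
  under eq_integral do rewrite EFinM.
  under [RHS]eq_integral do rewrite EFinM -muleA.
  rewrite !ge0_integralZl//.
  + congr (_ * _); rewrite integral_indic// setIT nuE//.
    rewrite integral_mkcond; apply: eq_integral => x _.
    by rewrite epatch_indic muleC.
  + apply: emeasurable_funM => //; exact/measurable_EFinP.
  + by move=> x _; rewrite mule_ge0// lee_fin.
  + by rewrite lee_fin.
  + exact/measurable_EFinP.
  + by rewrite lee_fin.
- move=> y; apply: emeasurable_funM => //; apply/measurable_EFinP.
  exact: measurable_funM.
- by move=> y x _; rewrite mule_ge0// ?nnfun_muleindic_ge0// lee_fin.
- by move=> y; apply/measurable_EFinP; exact: measurable_funM.
- by move=> y x _; exact: nnfun_muleindic_ge0.
Qed.

End density_integral.

Section density_theory.
Local Open Scope ereal_scope.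
Context {d dV : measure_display} {T : measurableType d}
  {V : measurableType dV} {R : realType}.
Variables (P : probability T R) (mu : {measure set V -> \bar R}).
Implicit Types (Z : T -> V) (f : V -> R).

Lemma expectation_density Z f (phi : V -> \bar R) :
  measurable_fun setT Z -> is_density mu P Z f ->
  measurable_fun setT phi -> (forall x, 0 <= phi x) ->
  \int[P]_t phi (Z t) = \int[mu]_x (phi x * (f x)%:E).
Proof.
move=> mZ [mf [f0 fE]] mphi phi0.
rewrite -(ge0_integral_density (nu := pushforward P Z)) //.
by rewrite ge0_integral_pushforward.
Qed.

Lemma integral_density Z f : is_density mu P Z f -> \int[mu]_x (f x)%:E = 1.
Proof. by move=> [_ [_ <-]]//; rewrite preimage_setT probability_setT. Qed.

Lemma integrable_density Z f :
  is_density mu P Z f -> mu.-integrable setT (EFin \o f).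
Proof.
move=> fd; have [mf [f0 _]] := fd; apply/integrableP; split.
  exact/measurable_EFinP.
under eq_integral do rewrite /= ger0_norm//.
by rewrite (integral_density fd) ltry.
Qed.

(** The law of [Z] is absolutely continuous with respect to [mu], so it does not charge [mu]-null
    sets. *)
Lemma density_ae Z f (Q : set V) : measurable_fun setT Z ->
  is_density mu P Z f ->
  {ae mu, forall x, Q x} -> {ae P, forall t, Q (Z t)}.
Proof.
move=> mZ [mf [f0 fE]] [N [mN N0 QN]]; exists (Z @^-1` N); split.
- by rewrite -[X in measurable X]setTI; exact: mZ.
- rewrite fE//; apply: null_set_integral => //.
  exact/measurable_funTS/measurable_EFinP.
- by move=> t /= nQ; exact: QN.
Qed.

(** The complementary event has as probability the integral of [f] over its own zero set. This makes
    logarithms and quotients of densities legitimate almost surely. *)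
Lemma density_gt0 Z f : measurable_fun setT Z -> is_density mu P Z f ->
  {ae P, forall t, (0 < f (Z t))%R}.
Proof.
move=> mZ [mf [f0 fE]].
have mN : measurable (f @^-1` [set 0%R]).
  by rewrite -[X in measurable X]setTI; exact: mf.
exists (Z @^-1` (f @^-1` [set 0%R])); split.
- by rewrite -[X in measurable X]setTI; exact: mZ.
- by rewrite fE// integral0_eq// => x /= ->.
- by move=> t /=; rewrite lt_def f0 andbT => /negP/negPn/eqP.
Qed.

(** The expectation is the integral of [q] over the set where [f] is positive: division by 0 gives
    0, so the rest of the space contributes nothing. *)
Lemma integral_ratio_le Z f (q : V -> R) (c : \bar R) :
  measurable_fun setT Z -> is_density mu P Z f ->
  measurable_fun setT q -> (forall x, (0 <= q x)%R) ->
  \int[mu]_x (q x)%:E <= c -> \int[P]_t (q (Z t) / f (Z t))%:E <= c.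
Proof.
move=> mZ fd mq q0; apply: le_trans; have [mf [f0 _]] := fd.
have mqf : measurable_fun setT (fun x => (q x / f x)%:E).
  apply/measurable_EFinP/measurable_funM => //.
  exact: measurableT_comp (@measurable_invr R) mf.
rewrite (expectation_density (phi := fun x => (q x / f x)%:E) mZ fd)//.
- apply: ge0_le_integral => //.
  + by move=> x _; rewrite -EFinM lee_fin mulr_ge0// divr_ge0.
  + by apply: emeasurable_funM => //; exact/measurable_EFinP.
  + exact/measurable_EFinP.
  + move=> x _; rewrite -EFinM lee_fin.
    have [->|fx0] := eqVneq (f x) 0%R; first by rewrite mulr0.
    by rewrite divfK.
- by move=> x; rewrite lee_fin divr_ge0.
Qed.

Lemma density_ae_unique Z f g : is_density mu P Z f -> is_density mu P Z g ->
  ae_eq mu setT (EFin \o f) (EFin \o g).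
Proof.
move=> fd gd; apply: integral_ae_eq => //.
- exact: integrable_density fd.
- by case: gd => mg _; exact/measurable_EFinP.
- by move=> A _ mA; case: fd gd => [_ [_ fE]] [_ [_ gE]]; rewrite -fE// -gE.
Qed.

(** The signed counterpart of [expectation_density]: multiplication by the nonnegative [f] commutes
    with taking positive and negative parts. *)
Lemma integrable_expectation Z f (phi : V -> R) :
  measurable_fun setT Z -> is_density mu P Z f -> measurable_fun setT phi ->
  mu.-integrable setT (fun x => (f x * phi x)%:E) ->
  P.-integrable setT (fun t => (phi (Z t))%:E) /\
  \int[P]_t (phi (Z t))%:E = \int[mu]_x (f x * phi x)%:E.
Proof.
move=> mZ fd mphi /integrableP[_ fi]; have [_ [f0 _]] := fd.
have mEphi : measurable_fun setT (EFin \o phi) by exact/measurable_EFinP.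
split.
  apply/integrableP; split.
    by apply/measurable_EFinP; exact: measurableT_comp.
  rewrite (expectation_density (phi := fun x => `|phi x|%:E) mZ fd)//.
  - apply: le_lt_trans fi; rewrite le_eqVlt; apply/orP; left; apply/eqP.
    apply: eq_integral => x _ /=.
    by rewrite -EFinM normrM (ger0_norm (f0 x)) mulrC.
  - exact/measurable_EFinP/measurableT_comp.
have posE x : (fun x => (f x * phi x)%:E)^\+ x =
    (EFin \o phi)^\+ x * (f x)%:E.
  rewrite !funeposE -!EFin_max -EFinM; congr EFin.
  by rewrite maxr_pMl// mul0r mulrC.
have negE x : (fun x => (f x * phi x)%:E)^\- x =
    (EFin \o phi)^\- x * (f x)%:E.
  rewrite !funenegE -!EFinN -!EFin_max -EFinM; congr EFin.
  by rewrite maxr_pMl// mul0r mulNr mulrC.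
rewrite [LHS]integralE [RHS]integralE; congr (_ - _).
- under [RHS]eq_integral do rewrite posE.
  rewrite -(expectation_density (phi := (EFin \o phi)^\+) mZ fd)//.
  + by apply: eq_integral => t _; rewrite !funeposE.
  + exact: measurable_funepos.
- under [RHS]eq_integral do rewrite negE.
  rewrite -(expectation_density (phi := (EFin \o phi)^\-) mZ fd)//.
  + by apply: eq_integral => t _; rewrite !funenegE.
  + exact: measurable_funeneg.
Qed.

(** [has_entropy] speaks of some density and [dentropy] of a chosen one. Almost-everywhere
    uniqueness allows any density [f] in both, and entropy becomes the expectation of a
    log-density. *)
Lemma has_entropy_density Z f : measurable_fun setT Z ->
  has_entropy mu P Z -> is_density mu P Z f ->
  P.-integrable setT (fun t => (ln (f (Z t)))%:E) /\
  dentropy mu P Z = (- \int[P]_t ln (f (Z t)))%R.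
Proof.
move=> mZ [g [gd gi]] fd; have [mf _] := fd.
have entropy_ae h1 h2 : is_density mu P Z h1 -> is_density mu P Z h2 ->
    ae_eq mu setT (fun x => (h1 x * ln (h1 x))%:E)
                  (fun x => (h2 x * ln (h2 x))%:E).
  move=> h1d h2d; apply: filterS (density_ae_unique h1d h2d) => x /= h12 _.
  by have /= [->] := h12 Logic.I.
have mentropy h : is_density mu P Z h ->
    measurable_fun setT (fun x => (h x * ln (h x))%:E).
  move=> [mh _]; apply/measurable_EFinP/measurable_funM => //.
  exact: measurableT_comp.
have fi : mu.-integrable setT (fun x => (f x * ln (f x))%:E).
  apply/integrableP; split; first exact: mentropy.
  have /integrableP[_] := gi; apply: le_lt_trans; rewrite le_eqVlt.
  apply/orP; left; apply/eqP; apply: ge0_ae_eq_integral => //.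
  - by apply: measurableT_comp => //; exact: mentropy.
  - by apply: measurableT_comp => //; exact: mentropy.
  - exact: (ae_eq_comp abse (entropy_ae _ _ fd gd)).
have [lni lnE] := integrable_expectation (phi := fun x => ln (f x)) mZ fd
  (measurableT_comp (@measurable_ln R) mf) fi.
split=> //; rewrite /dentropy /Rintegral lnE.
(* [f] witnesses that a density exists, so the chosen function is one. *)
have dd : is_density mu P Z (density_of mu P Z).
  exact: (xgetPex _ (ex_intro _ f fd)).
congr (- fine _)%R; apply: ae_eq_integral => //.
- exact: mentropy.
- exact: mentropy.
- exact: entropy_ae.
Qed.

End density_theory.

(** * Measure-preserving maps, change of variables and marginals *)

Section measure_preserving.
Local Open Scope ereal_scope.

Definition measure_preserving {d d' : measure_display} {R : realType}
    {V : measurableType d} {V' : measurableType d'}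
    (mu : set V -> \bar R) (mu' : set V' -> \bar R) (phi : V -> V') : Prop :=
  measurable_fun setT phi /\
  forall A, measurable A -> mu' A = mu (phi @^-1` A).

Context {R : realType}.

Lemma measure_preserving_comp {d d' d'' : measure_display}
    {V : measurableType d} {V' : measurableType d'} {V'' : measurableType d''}
    (mu : set V -> \bar R) (mu' : set V' -> \bar R) (mu'' : set V'' -> \bar R)
    (phi : V -> V') (psi : V' -> V'') :
  measure_preserving mu mu' phi -> measure_preserving mu' mu'' psi ->
  measure_preserving mu mu'' (psi \o phi).
Proof.
move=> [mphi phiE] [mpsi psiE]; split; first exact: measurableT_comp.
move=> A mA; rewrite psiE// phiE//.
by rewrite -[X in measurable X]setTI; exact: mpsi.
Qed.

(** Pulled back along [phi], the function [f \o psi] becomes [f]. The Jacobian factor is 1 because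
    [phi] preserves the measures. *)
Lemma density_map {d d' dT : measure_display} {T : measurableType dT}
    {V : measurableType d} {V' : measurableType d'} (P : probability T R)
    (mu : {measure set V -> \bar R}) (mu' : {measure set V' -> \bar R})
    (phi : V -> V') (psi : V' -> V) (Z : T -> V) (f : V -> R) :
  measure_preserving mu mu' phi -> measurable_fun setT psi ->
  cancel phi psi -> is_density mu P Z f ->
  is_density mu' P (phi \o Z) (f \o psi).
Proof.
move=> [mphi phiE] mpsi phiK [mf [f0 fE]].
split; first exact: measurableT_comp.
split=> [x //|A mA]; first exact: f0.
rewrite comp_preimage fE; last first.
  by rewrite -[X in measurable X]setTI; exact: mphi.
rewrite (eq_measure_integral (pushforward mu phi)); last first.
  by move=> B mB _; rewrite phiE.
rewrite [RHS]ge0_integral_pushforward//.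
- by apply: eq_integral => x _ /=; rewrite phiK.
- exact/measurable_funTS/measurable_EFinP/measurableT_comp.
- by move=> x _; rewrite lee_fin; exact: f0.
Qed.

Section products.
Context {d1 d2 d3 : measure_display} {V1 : measurableType d1}
  {V2 : measurableType d2} {V3 : measurableType d3}.
Variables (m1 : {sigma_finite_measure set V1 -> \bar R})
  (m2 : {sigma_finite_measure set V2 -> \bar R})
  (m3 : {sigma_finite_measure set V3 -> \bar R}).

Lemma product_measure_ysection (A : set (V1 * V2)) : measurable A ->
  (m1 \X m2) A = \int[m2]_y m1 (ysection A y).
Proof.
move=> mA; apply: (product_measure_unique (m' := m1 \x^ m2)) => //.
by move=> B C mB mC; exact: product_measure2E.
Qed.

Lemma measure_preserving_swap :
  measure_preserving (m1 \X m2) (m2 \X m1) (fun z => (z.2, z.1)).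
Proof.
have mswap : measurable_fun [set: V1 * V2] (fun z => (z.2, z.1)).
  exact: measurable_fun_pair.
split=> // A mA; rewrite product_measure_ysection; last first.
  by rewrite -[X in measurable X]setTI; exact: mswap.
by apply: eq_integral => y _; congr (m1 _); apply/seteqP; split => x;
  rewrite /xsection /ysection /= !inE.
Qed.

(** By uniqueness of the product measure it is enough to treat sets B x C, with B in the first and
    third coordinates; there the Tonelli integral factors. *)
Lemma measure_preserving_rot :
  measure_preserving (m1 \X m2 \X m3) (m1 \X m3 \X m2)
    (fun z => ((z.1.1, z.2), z.1.2)).
Proof.
have mrot : measurable_fun [set: V1 * V2 * V3]
    (fun z => ((z.1.1, z.2), z.1.2)).
  apply: measurable_fun_pair; last exact: measurableT_comp.
  by apply: measurable_fun_pair => //; exact: measurableT_comp.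
split=> // A mA.
apply: (product_measure_unique (m' := pushforward (m1 \X m2 \X m3)
    (fun z => ((z.1.1, z.2), z.1.2)))) => // B C mB mC.
rewrite /pushforward {1}/prod_measure {1}/product_measure1.
(* The section at (u, v) is the section of [B] at u if v is in [C], and is empty otherwise. *)
transitivity (\int[(m1 \x m2)%E]_z (m3 (xsection B z.1) * (\1_C z.2)%:E)).
  apply: eq_integral => -[u v] _ /=; rewrite indicE.
  have [vC|vC] := boolP (v \in C).
    rewrite mule1; congr (m3 _); apply/seteqP; split => w;
      rewrite /xsection /= !inE; first by case.
    by move=> ?; split=> //; exact: set_mem.
  rewrite mule0 (_ : xsection _ _ = set0) ?measure0//.
  apply/seteqP; split => w //; rewrite /xsection /= !inE => -[_ /= Cv].
  by move/negP: vC; apply; exact/mem_set.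
have mB3 : measurable_fun setT (fun x => m3 (xsection B x)).
  exact: measurable_fun_xsection.
rewrite fubini_tonelli1//; last 2 first.
- apply: emeasurable_funM; first exact: (measurableT_comp mB3 measurable_fst).
  apply/measurable_EFinP.
  exact: (measurableT_comp (measurable_indic mC) measurable_snd).
- by move=> z; rewrite mule_ge0// lee_fin.
rewrite /fubini_F /=.
transitivity (\int[m1]_x (m3 (xsection B x) * m2 C)).
  apply: eq_integral => x _; rewrite ge0_integralZl//; last first.
    exact/measurable_EFinP.
  by rewrite integral_indic// setIT.
by rewrite ge0_integralZr.
Qed.

Lemma measure_preserving_prodl {d1' : measure_display}
    {V1' : measurableType d1'} (m1' : {sigma_finite_measure set V1' -> \bar R})
    (phi : V1 -> V1') :
  measure_preserving m1 m1' phi ->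
  measure_preserving (m1 \X m2) (m1' \X m2) (fun z => (phi z.1, z.2)).
Proof.
move=> [mphi phiE].
have mpair : measurable_fun [set: V1 * V2] (fun z => (phi z.1, z.2)).
  by apply: measurable_fun_pair => //; exact: measurableT_comp.
split=> // A mA; apply: (product_measure_unique
  (m' := pushforward (m1 \X m2) (fun z => (phi z.1, z.2)))) => // B C mB mC.
rewrite phiE//.
rewrite -product_measure1E//; last first.
  by rewrite -[X in measurable X]setTI; exact: mphi.
Qed.

End products.

(** A shear translates each fibre, and [leb1] is translation invariant. Shears and coordinate
    exchanges compose to the change of variables applied to the chain. *)
Lemma measure_preserving_shear {d : measure_display} {V : measurableType d}
    (m : {sigma_finite_measure set V -> \bar R}) (h : V -> R) :
  measurable_fun setT h ->
  measure_preserving (m \X @leb1 R) (m \X @leb1 R)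
    (fun z => (z.1, (z.2 + h z.1)%R)).
Proof.
move=> mh; split.
  apply: measurable_fun_pair => //; apply: measurable_funD => //.
  exact: measurableT_comp.
move=> A mA; apply: eq_integral => x _ /=.
rewrite -(leb1_shift (h x)); last exact: measurable_xsection.
by congr leb1; apply/seteqP; split => y; rewrite /xsection /= !inE.
Qed.

End measure_preserving.

(** Tonelli integrates out the second coordinate. The inner integral may be +oo, where [fine] gives
    0; integrability of [f] confines this to a null set. *)
Lemma density_fst {R : realType} {d d1 d2 : measure_display}
    {T : measurableType d} {V1 : measurableType d1} {V2 : measurableType d2}
    (P : probability T R) (m1 : {sigma_finite_measure set V1 -> \bar R})
    (m2 : {sigma_finite_measure set V2 -> \bar R}) (A : T -> V1) (B : T -> V2)
    (f : V1 * V2 -> R) :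
  is_density (m1 \X m2) P (pairRV A B) f ->
  is_density m1 P A (fun x => fine (\int[m2]_y (f (x, y))%:E)).
Proof.
move=> fd; have [mf [f0 fE]] := fd.
have mEf : measurable_fun setT (EFin \o f) by exact/measurable_EFinP.
have mF := measurable_fun_fubini_tonelli_F (m2 := m2) (EFin \o f) mEf
  (fun x => f0 x).
have F0 x : (0 <= \int[m2]_y (f (x, y))%:E)%E.
  by apply: integral_ge0 => y _; rewrite lee_fin.
split; first exact: measurableT_comp.
split=> [x|S mS]; first exact: fine_ge0.
have -> : A @^-1` S = pairRV A B @^-1` (S `*` setT).
  by apply/seteqP; split => t //= -[].
rewrite fE; last exact: measurableX.
rewrite integral_mkcond /prod_measure fubini_tonelli1//=; last 2 first.
- apply/(measurable_restrictT _ _).1 => //; first exact: measurableX.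
  exact: measurable_funTS.
- by move=> z; rewrite /patch; case: ifP => // _; rewrite lee_fin.
have Fi : m1.-integrable setT (fubini_F m2 (EFin \o f)).
  exact/integrable_fubini_F/(integrable_density fd).
transitivity (\int[m1]_(x in S) fubini_F m2 (EFin \o f) x)%E.
  rewrite [RHS]integral_mkcond; apply: eq_integral => x _.
  rewrite /fubini_F patchE; case: ifPn => xS.
    apply: eq_integral => y _; rewrite patchE ifT// inE; split => //=.
    exact: set_mem.
  apply: integral0_eq => y _; rewrite patchE ifF//.
  by apply/negbTE; apply: contra xS => /set_mem[/= /mem_set].
apply: ge0_ae_eq_integral => //.
- exact: measurable_funTS.
- by apply/measurable_funTS/measurable_EFinP; exact: measurableT_comp.
- by move=> x _; exact: F0.
- by move=> x _; rewrite lee_fin fine_ge0.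
- have := integrable_ae measurableT Fi; apply: filterS => x Fx _ /=.
  by rewrite fineK//; exact: Fx.
Qed.

(** * Joint density under conditional independence *)

Section density_measure.
Local Open Scope ereal_scope.
Context {d : measure_display} {V : measurableType d} {R : realType}.
Variables (mu : {measure set V -> \bar R}) (f : V -> R).
Hypotheses (mf : measurable_fun setT f) (f0 : forall x, (0 <= f x)%R).

(** The two proofs are arguments so that the measure instance, which depends on them, can be
    inferred from the term. *)
Definition density_measure of
    measurable_fun setT f & (forall x, (0 <= f x)%R) :=
  fun A : set V => \int[mu]_(x in A) (f x)%:E.

Local Notation nu := (density_measure mf f0).

Let density_measure0 : nu set0 = 0.
Proof. exact: integral_set0. Qed.

Let density_measure_ge0 A : 0 <= nu A.
Proof. by apply: integral_ge0 => x _; rewrite lee_fin. Qed.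

Let density_measure_sigma_additive : semi_sigma_additive nu.
Proof.
move=> F mF tF mUF; rewrite /density_measure; apply: cvg_toP.
  apply: ereal_nondecreasing_is_cvgn => m n mn.
  apply: lee_sum_nneg_natr => // k _ _.
  by apply: integral_ge0 => x _; rewrite lee_fin.
rewrite ge0_integral_bigcup//.
- exact/measurable_funTS/measurable_EFinP.
- by move=> x _; rewrite lee_fin.
Qed.

HB.instance Definition _ := isMeasure.Build _ _ _ nu
  density_measure0 density_measure_ge0 density_measure_sigma_additive.

End density_measure.

(** Rectangles are stable under intersection and generate the product sigma-algebra. *)
Lemma finite_measure_prod_unique {R : realType} {d1 d2 : measure_display}
  {V1 : measurableType d1} {V2 : measurableType d2}
  (n1 n2 : {measure set (V1 * V2) -> \bar R}) :
  (n1 setT < +oo)%E ->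
  (forall A B, measurable A -> measurable B -> n1 (A `*` B) = n2 (A `*` B)) ->
  forall X, measurable X -> n1 X = n2 X.
Proof.
move=> n1T n12.
apply: (measure_unique [set A `*` B | A in measurable & B in measurable]
  (fun=> setT)) => //.
- exact: measurable_prod_measurableType.
- move=> _ _ [A mA [B mB <-]] [A' mA' [B' mB' <-]]; rewrite -setXI.
  by exists (A `&` A'); [exact: measurableI|exists (B `&` B') => //;
    exact: measurableI].
- by move=> _; exists setT => //; exists setT => //; rewrite setXTT.
- by rewrite bigcup_const.
- by move=> _ [A mA [B mB <-]]; exact: n12.
Qed.

(** Two applications of the two-factor case: for a fixed C, restricting the third coordinate to C
    and projecting to the first two leaves finite measures that agree on rectangles. *)
Lemma finite_measure_prod3_unique {R : realType} {d1 d2 d3 : measure_display}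
  {V1 : measurableType d1} {V2 : measurableType d2} {V3 : measurableType d3}
  (n1 n2 : {measure set (V1 * V2 * V3) -> \bar R}) :
  (n1 setT < +oo)%E ->
  (forall A B C, measurable A -> measurable B -> measurable C ->
    n1 (A `*` B `*` C) = n2 (A `*` B `*` C)) ->
  forall X, measurable X -> n1 X = n2 X.
Proof.
move=> n1T n12; apply: finite_measure_prod_unique => // D C mD mC.
have mTC : measurable ([set: V1 * V2] `*` C) by exact: measurableX.
have DCE (D' : set (V1 * V2)) :
    fst @^-1` D' `&` [set: V1 * V2] `*` C = D' `*` C.
  by apply/seteqP; split => z /=; [case=> ? []|case].
pose m1 := pushforward (mrestr n1 mTC) (@fst (V1 * V2)%type V3).
pose m2 := pushforward (mrestr n2 mTC) (@fst (V1 * V2)%type V3).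
suff : m1 D = m2 D by rewrite /m1 /m2 /pushforward /mrestr DCE.
apply: finite_measure_prod_unique => //.
- apply: le_lt_trans n1T; rewrite /= /pushforward /mrestr.
  by rewrite preimage_setT setTI; apply: le_measure; rewrite ?inE.
- by move=> A B mA mB; rewrite /= /pushforward /mrestr !DCE n12.
Qed.

Section density_cond_indep.
Local Open Scope ereal_scope.
Context {d dU dV dW : measure_display} {T : measurableType d}
  {U : measurableType dU} {V : measurableType dV} {W : measurableType dW}
  {R : realType}.
Variables (P : probability T R) (mA : {sigma_finite_measure set U -> \bar R})
  (mB : {sigma_finite_measure set V -> \bar R})
  (mC : {sigma_finite_measure set W -> \bar R})
  (A : T -> U) (B : T -> V) (C : T -> W)
  (fAC : U * W -> R) (fBC : V * W -> R) (fC : W -> R).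
Hypotheses (mesA : measurable_fun setT A) (mesB : measurable_fun setT B)
  (mesC : measurable_fun setT C).
Hypothesis ACd : is_density (mA \X mC) P (pairRV A C) fAC.
Hypothesis BCd : is_density (mB \X mC) P (pairRV B C) fBC.
Hypothesis Cd : is_density mC P C fC.

(** The unnormalized conditional law of [B] given C = c; divided by fC(c), it is what the kernel
    must be almost everywhere. *)
Let G (SB : set V) (c : W) := \int[mB]_(b in SB) (fBC (b, c))%:E.

Let fBC0 z : (0 <= fBC z)%R. Proof. by case: BCd => _ []. Qed.
Let fAC0 z : (0 <= fAC z)%R. Proof. by case: ACd => _ []. Qed.
Let fC0 z : (0 <= fC z)%R. Proof. by case: Cd => _ []. Qed.

Let G0 SB c : 0 <= G SB c.
Proof. by apply: integral_ge0 => b _; rewrite lee_fin. Qed.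

Let GE SB c : G SB c = fubini_G mB ((EFin \o fBC) \_ (SB `*` setT)) c.
Proof.
rewrite /G integral_mkcond; apply: eq_integral => b _; rewrite !patchE.
by congr (if _ then _ else _); apply/idP/idP => /set_mem;
  [move=> ?; apply/mem_set; split|case=> /= ? _; exact/mem_set].
Qed.

Let mfBC SB : measurable SB ->
  measurable_fun setT ((EFin \o fBC) \_ (SB `*` [set: W])).
Proof.
move=> mSB; apply/(measurable_restrictT _ _).1; first exact: measurableX.
by apply/measurable_funTS/measurable_EFinP; case: BCd.
Qed.

Let fBC_ge0 SB z : 0 <= ((EFin \o fBC) \_ (SB `*` [set: W])) z.
Proof. by rewrite patchE; case: ifP => // _; rewrite lee_fin. Qed.

Let mG SB : measurable SB -> measurable_fun setT (G SB).
Proof.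
move=> mSB; rewrite (funext (GE SB)).
exact: measurable_fun_fubini_tonelli_G (mfBC mSB) (fBC_ge0 SB).
Qed.

Let integral_G SB SC : measurable SB -> measurable SC ->
  \int[mC]_(c in SC) G SB c = P (B @^-1` SB `&` C @^-1` SC).
Proof.
move=> mSB mSC; have [mf [_ fE]] := BCd.
transitivity (P (pairRV B C @^-1` (SB `*` SC))) => //.
have mBC : measurable (SB `*` SC) by exact: measurableX.
rewrite fE// [RHS]integral_mkcond /prod_measure fubini_tonelli2//; last 2 first.
- apply/(measurable_restrictT _ _).1 => //.
  exact/measurable_funTS/measurable_EFinP.
- by move=> z; rewrite patchE; case: ifP => // _; rewrite lee_fin.
rewrite [LHS]integral_mkcond; apply: eq_integral => c _.
rewrite /fubini_G patchE; case: ifPn => cSC.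
  rewrite [LHS]integral_mkcond; apply: eq_integral => b _; rewrite !patchE.
  by rewrite in_setX cSC andbT.
by rewrite integral0_eq// => b _; rewrite patchE in_setX (negbTE cSC) andbF.
Qed.

Section kernel.
Variable k : R.-pker W ~> V.
Hypothesis kE : forall SA SB SC,
  measurable SA -> measurable SB -> measurable SC ->
  P (A @^-1` SA `&` B @^-1` SB `&` C @^-1` SC) =
  \int[P]_(t in A @^-1` SA `&` C @^-1` SC) k (C t) SB.

Let mk SB : measurable SB -> measurable_fun setT (k ^~ SB).
Proof. exact: measurable_kernel. Qed.

Let integral_kernel SB SC : measurable SB -> measurable SC ->
  \int[mC]_(c in SC) (k c SB * (fC c)%:E) = P (B @^-1` SB `&` C @^-1` SC).
Proof.
move=> mSB mSC.
rewrite -[B @^-1` SB]setTI -[X in X `&` _ `&` _](preimage_setT A).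
rewrite kE// preimage_setT setTI integral_mkcond [RHS]integral_mkcond.
transitivity (\int[mC]_c (((k ^~ SB) \_ SC) c * (fC c)%:E)).
  by apply: eq_integral => c _; rewrite !patchE; case: ifP; rewrite ?mul0e.
rewrite -(expectation_density mesC Cd (phi := (k ^~ SB) \_ SC)).
- by apply: eq_integral => t _; rewrite !patchE.
- by apply/(measurable_restrictT _ _).1 => //; exact/measurable_funTS/mk.
- by move=> c; rewrite patchE; case: ifP.
Qed.

(** Over every measurable SC, both k(c, SB) fC(c) and G SB c integrate to the probability that B is
    in SB and C in SC, so they agree almost everywhere. Positivity of fC(C) almost surely permits
    the division. *)
Let kernelE SB : measurable SB ->
  {ae P, forall t, k (C t) SB = G SB (C t) * ((fC (C t))^-1)%:E}.
Proof.
move=> mSB; have [mfC _] := Cd.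
have mkf : measurable_fun setT (fun c => k c SB * (fC c)%:E).
  by apply: emeasurable_funM; [exact: mk|exact/measurable_EFinP].
have kG : ae_eq mC setT (fun c => k c SB * (fC c)%:E) (G SB).
  apply: integral_ae_eq => //; last 2 first.
  - exact: mG.
  - by move=> E _ mE; rewrite integral_kernel// integral_G.
  apply/integrableP; split=> //.
  under eq_integral do rewrite gee0_abs ?mule_ge0 ?lee_fin//.
  rewrite integral_kernel//; apply: le_lt_trans (ltry 1).
  by apply: probability_le1; apply: measurableI;
    rewrite -[X in measurable X]setTI; [exact: mesB|exact: mesC].
apply: filterS2 (density_ae mesC Cd kG) (density_gt0 mesC Cd) => t /= kGt fCt.
by rewrite -kGt// -muleA -EFinM divff ?mule1// gt_eqF.
Qed.

Let h (z : U * W * V) := (fAC z.1 * fBC (z.2, z.1.2) / fC z.1.2)%R.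

Let mh : measurable_fun setT h.
Proof.
have [mfAC _] := ACd; have [mf _] := BCd; have [mfC _] := Cd.
have m2 : measurable_fun [set: U * W * V] (fun z => z.1.2).
  exact: measurableT_comp.
apply: measurable_funM.
  apply: measurable_funM; first exact: measurableT_comp.
  by apply: (measurableT_comp mf); exact: measurable_fun_pair.
by apply: (measurableT_comp (@measurable_invr R)); exact: measurableT_comp.
Qed.

Let h0 z : (0 <= h z)%R.
Proof. by rewrite divr_ge0// mulr_ge0. Qed.

Let integral_h SA SC SB : measurable SA -> measurable SC -> measurable SB ->
  \int[mA \X mC \X mB]_(z in SA `*` SC `*` SB) (h z)%:E =
  \int[mA \X mC]_(z in SA `*` SC)
    (G SB z.2 * ((fC z.2)^-1)%:E * (fAC z)%:E).
Proof.
move=> mSA mSC mSB; have [mf _] := BCd.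
have mSS : measurable (SA `*` SC `*` SB).
  by apply: measurableX => //; exact: measurableX.
rewrite integral_mkcond {1}/prod_measure fubini_tonelli1//; last 2 first.
- apply/(measurable_restrictT _ _).1 => //.
  exact/measurable_funTS/measurable_EFinP.
- by move=> z; rewrite patchE; case: ifP => // _; rewrite lee_fin.
rewrite [RHS]integral_mkcond; apply: eq_integral => z _.
rewrite /fubini_F patchE; case: ifPn => zS; last first.
  by rewrite integral0_eq// => b _; rewrite patchE in_setX (negbTE zS).
transitivity (\int[mB]_(b in SB) ((fAC z / fC z.2)%:E * (fBC (b, z.2))%:E)).
  rewrite [RHS]integral_mkcond; apply: eq_integral => b _; rewrite !patchE.
  rewrite in_setX zS /=; case: ifP => // _.
  by rewrite /h -EFinM mulrAC.
rewrite ge0_integralZl//.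
- by rewrite muleC -muleA -EFinM mulrC.
- apply/measurable_funTS/measurable_EFinP/(measurableT_comp mf).
  exact: measurable_fun_pair.
- by move=> b _; rewrite lee_fin.
- by rewrite lee_fin divr_ge0.
Qed.

(** Conditional independence expresses the probability of a box through [k]; [kernelE] replaces the
    kernel by G / fC, and the density of (A, C) turns the expectation into an integral. *)
Let density_rect SA SC SB : measurable SA -> measurable SC -> measurable SB ->
  P (pairRV (pairRV A C) B @^-1` (SA `*` SC `*` SB)) =
  \int[mA \X mC \X mB]_(z in SA `*` SC `*` SB) (h z)%:E.
Proof.
move=> mSA mSC mSB; have [mfC _] := Cd; have [mfAC _] := ACd.
have mAC : measurable_fun setT (pairRV A C) by exact: measurable_fun_pair.
transitivity (P (A @^-1` SA `&` B @^-1` SB `&` C @^-1` SC)).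
  by congr (P _); apply/seteqP; split => t /=;
    [move=> [[] ? ? ?]|move=> [[] ? ? ?]].
have mD : measurable (A @^-1` SA `&` C @^-1` SC).
  by apply: measurableI; rewrite -[X in measurable X]setTI;
    [exact: mesA|exact: mesC].
have mphi : measurable_fun [set: U * W]
    (fun z => G SB z.2 * ((fC z.2)^-1)%:E).
  apply: emeasurable_funM.
    exact: (measurableT_comp (mG mSB) measurable_snd).
  apply/measurable_EFinP/(measurableT_comp (@measurable_invr R)).
  exact: measurableT_comp.
rewrite kE// integral_h// [RHS]integral_mkcond.
pose phi := (fun z : U * W => G SB z.2 * ((fC z.2)^-1)%:E) \_ (SA `*` SC).
transitivity (\int[P]_t phi (pairRV A C t)); last first.
  rewrite (expectation_density mAC ACd)//.
  - apply: eq_integral => z _; rewrite /phi !patchE.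
    by case: ifP; rewrite ?mul0e.
  - apply/(measurable_restrictT _ _).1; first exact: measurableX.
    exact: measurable_funTS.
  - move=> z; rewrite /phi patchE; case: ifP => // _.
    by rewrite mule_ge0// lee_fin invr_ge0.
transitivity (\int[P]_(t in A @^-1` SA `&` C @^-1` SC)
    (G SB (C t) * ((fC (C t))^-1)%:E)); last first.
  by rewrite integral_mkcond; apply: eq_integral => t _; rewrite /phi !patchE.
apply: ge0_ae_eq_integral => //.
- exact/measurable_funTS/(measurableT_comp (mk mSB)).
- exact/measurable_funTS/(measurableT_comp mphi mAC).
- by move=> t _; rewrite mule_ge0// lee_fin invr_ge0.
- by apply: filterS (kernelE mSB) => t.
Qed.

(** Boxes determine a finite measure on a triple product, so [density_rect] suffices. *)
Lemma density_kernel :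
  is_density (mA \X mC \X mB) P (pairRV (pairRV A C) B) h.
Proof.
split=> //; split=> // S mS.
have mZ : measurable_fun setT (pairRV (pairRV A C) B).
  by apply: measurable_fun_pair => //; exact: measurable_fun_pair.
apply: (finite_measure_prod3_unique
  (n1 := pushforward P (pairRV (pairRV A C) B))
  (n2 := density_measure (mA \X mC \X mB) mh h0)) => //.
by rewrite /= /pushforward preimage_setT probability_setT ltry.
Qed.

End kernel.

Lemma density_cond_indep : cond_indep P A B C ->
  is_density (mA \X mC \X mB) P (pairRV (pairRV A C) B)
    (fun z => fAC z.1 * fBC (z.2, z.1.2) / fC z.1.2)%R.
Proof. by move=> [k kE]; exact: (density_kernel (k := k)). Qed.

End density_cond_indep.

(** * Expectation values and upper bounds *)

Section expectation_value.
Context {d : measure_display} {T : measurableType d} {R : realType}.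
Variable P : probability T R.
Implicit Types (L : T -> R) (v : R).

(** Integrability and value are bundled so that linear combinations of log-densities can be
    assembled term by term. *)
Definition has_expectation L v : Prop :=
  P.-integrable setT (fun t => (L t)%:E) /\ \int[P]_t L t = v.

Lemma has_expectationD L1 L2 v1 v2 :
  has_expectation L1 v1 -> has_expectation L2 v2 ->
  has_expectation (fun t => L1 t + L2 t) (v1 + v2).
Proof.
move=> [i1 <-] [i2 <-]; split; first exact: (integrableD measurableT i1 i2).
exact: RintegralD.
Qed.

Lemma has_expectationB L1 L2 v1 v2 :
  has_expectation L1 v1 -> has_expectation L2 v2 ->
  has_expectation (fun t => L1 t - L2 t) (v1 - v2).
Proof.
move=> [i1 <-] [i2 <-]; split; first exact: (integrableB measurableT i1 i2).
exact: RintegralB.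
Qed.

Lemma has_expectation_ae_unique L1 L2 v1 v2 :
  has_expectation L1 v1 -> has_expectation L2 v2 ->
  {ae P, forall t, L1 t = L2 t} -> v1 = v2.
Proof.
move=> [i1 <-] [i2 <-] L12; congr fine; apply: ae_eq_integral => //.
- exact: measurable_int i1.
- exact: measurable_int i2.
- by apply: filterS L12 => t ->.
Qed.

Definition expectation_le (e : T -> R) (c : R) : Prop :=
  [/\ measurable_fun setT e, forall t, 0 <= e t &
      (\int[P]_t (e t)%:E <= c%:E)%E].

Lemma expectation_leD e1 e2 c1 c2 :
  expectation_le e1 c1 -> expectation_le e2 c2 ->
  expectation_le (fun t => e1 t + e2 t) (c1 + c2).
Proof.
move=> [me1 e10 le1] [me2 e20 le2]; split.
- exact: measurable_funD.
- by move=> t; rewrite addr_ge0.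
- under eq_integral do rewrite EFinD.
  rewrite ge0_integralD//; first by rewrite EFinD leeD.
  + by move=> t _; rewrite lee_fin.
  + exact/measurable_EFinP.
  + by move=> t _; rewrite lee_fin.
  + exact/measurable_EFinP.
Qed.

Lemma expectation_le_ratio {dV : measure_display} {V : measurableType dV}
    (mu : {measure set V -> \bar R}) (Z : T -> V) (f q : V -> R) :
  measurable_fun setT Z -> is_density mu P Z f ->
  measurable_fun setT q -> (forall x, 0 <= q x) ->
  (\int[mu]_x (q x)%:E <= 1)%E ->
  expectation_le (fun t => q (Z t) / f (Z t)) 1.
Proof.
move=> mZ fd mq q0 q1; have [mf [f0 _]] := fd; split.
- apply: measurable_funM; first exact: measurableT_comp.
  by apply: (measurableT_comp (@measurable_invr R)); exact: measurableT_comp.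
- by move=> t; rewrite divr_ge0.
- exact: integral_ratio_le q1.
Qed.

Lemma has_expectation_le0 L v (e : T -> R) (c : R) :
  has_expectation L v -> expectation_le e c ->
  {ae P, forall t, L t <= e t - c} -> v <= 0.
Proof.
move=> [Li <-] [me e0 ec] Le.
have mL := measurable_int _ Li.
have ei : P.-integrable setT (fun t => (e t)%:E).
  apply/integrableP; split; first exact/measurable_EFinP.
  under eq_integral do rewrite gee0_abs ?lee_fin//.
  exact: le_lt_trans ec (ltry _).
have ci : P.-integrable setT (fun=> c%:E).
  exact: finite_measure_integrable_cst.
have di := integrableB measurableT (integrableB measurableT ei ci) Li.
have : (0 <= \int[P]_t ((e t)%:E - c%:E - (L t)%:E))%E.
  (* The integrand is nonnegative only almost everywhere; its absolute value is so everywhere, as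
     [integral_ge0] asks. *)
  rewrite (@ae_eq_integral _ _ _ _ _
    (fun t => `|(e t)%:E - c%:E - (L t)%:E|%E))//.
  - exact: integral_ge0.
  - exact: measurable_int di.
  - by apply: measurableT_comp => //; exact: measurable_int di.
  - apply: filterS Le => t Lt _ /=; rewrite ger0_norm//.
    by rewrite subr_ge0.
rewrite integralB//; last exact: (integrableB measurableT ei ci).
rewrite integralB// integral_cst//= probability_setT mule1.
have efin := integrable_fin_num measurableT ei.
have Lfin := integrable_fin_num measurableT Li.
have ec' : fine (\int[P]_t (e t)%:E) <= c by rewrite -lee_fin fineK.
rewrite -(fineK efin) -(fineK Lfin) -!EFinB lee_fin /Rintegral.
move: ec'; set E := fine _; set I := fine _; lra.
Qed.

End expectation_value.

(** * Random variables with the same law *)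

Section density_law.
Context {d dV : measure_display} {T : measurableType d}
  {V : measurableType dV} {R : realType}.
Variables (P : probability T R) (mu : {measure set V -> \bar R}).
Variables Z Z' : T -> V.

Definition same_law : Prop :=
  forall A, measurable A -> P (Z @^-1` A) = P (Z' @^-1` A).

(** An equality of predicates, so that the choice in [density_of] returns the same function for both
    variables and entropy transfers by rewriting. *)
Lemma is_density_same_law : same_law -> is_density mu P Z = is_density mu P Z'.
Proof.
move=> ZZ'; apply/funext => f; apply/propext.
by split=> -[mf [f0 fE]]; split=> //; split=> // A mA; rewrite -fE// ZZ'.
Qed.

Lemma dentropy_same_law : same_law -> dentropy mu P Z = dentropy mu P Z'.
Proof. by move=> ZZ'; rewrite /dentropy /density_of is_density_same_law. Qed.

Lemma has_entropy_same_law : same_law ->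
  has_entropy mu P Z -> has_entropy mu P Z'.
Proof. by move=> ZZ'; rewrite /has_entropy is_density_same_law. Qed.

Lemma density_eq_measure (mu' : {measure set V -> \bar R}) f :
  (forall A, measurable A -> mu A = mu' A) ->
  is_density mu P Z f -> is_density mu' P Z f.
Proof.
move=> mumu' [mf [f0 fE]]; split=> //; split=> // A mA; rewrite fE//.
by apply: eq_measure_integral => B mB _; exact: mumu'.
Qed.

End density_law.

Lemma same_law_comp {d dV dV' : measure_display} {T : measurableType d}
    {V : measurableType dV} {V' : measurableType dV'} {R : realType}
    (P : probability T R) (Z Z' : T -> V) (phi : V -> V') :
  measurable_fun setT phi -> same_law P Z Z' ->
  same_law P (phi \o Z) (phi \o Z').
Proof.
move=> mphi ZZ' A mA; apply: (ZZ' (phi @^-1` A)).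
by rewrite -[X in measurable X]setTI; exact: mphi.
Qed.

(** The same kernel works, with the whole space as the event for [A']. *)
Lemma cond_indep_snd {d dU dU' dV dW : measure_display} {T : measurableType d}
    {U : measurableType dU} {U' : measurableType dU'} {V : measurableType dV}
    {W : measurableType dW} {R : realType} (P : probability T R)
    (A' : T -> U') (A : T -> U) (B : T -> V) (C : T -> W) :
  cond_indep P (pairRV A' A) B C -> cond_indep P A B C.
Proof.
move=> [k kE]; exists k => SA SB SC mSA mSB mSC.
have -> : A @^-1` SA = pairRV A' A @^-1` (setT `*` SA).
  by apply/seteqP; split => t //= -[].
by apply: kE => //; exact: measurableX.
Qed.

(** * Subprobability densities and the logarithmic inequality *)

Section product_integral.
Local Open Scope ereal_scope.
Context {R : realType} {d1 d2 : measure_display} {V1 : measurableType d1}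
  {V2 : measurableType d2}.
Variables (m1 : {sigma_finite_measure set V1 -> \bar R})
  (m2 : {sigma_finite_measure set V2 -> \bar R}).

(** Tonelli, integrating [v] first. The numerators of the four ratios are products of this shape. *)
Lemma integral_prod_le1 (u : V1 -> R) (v : V1 * V2 -> R) :
  measurable_fun setT u -> (forall x, (0 <= u x)%R) ->
  measurable_fun setT v -> (forall z, (0 <= v z)%R) ->
  \int[m1]_x (u x)%:E <= 1 ->
  (forall x, \int[m2]_y (v (x, y))%:E <= 1) ->
  \int[m1 \X m2]_z (u z.1 * v z)%:E <= 1.
Proof.
move=> mu u0 mv v0 u1 v1.
have muv : measurable_fun setT (fun z => (u z.1 * v z)%:E).
  by apply/measurable_EFinP/measurable_funM => //; exact: measurableT_comp.
have uv0 z : 0 <= (u z.1 * v z)%:E by rewrite lee_fin mulr_ge0.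
rewrite /prod_measure fubini_tonelli1//; apply: le_trans u1.
apply: ge0_le_integral => //.
- by move=> x _; apply: integral_ge0 => y _; exact: uv0.
- exact: measurable_fun_fubini_tonelli_F.
- exact/measurable_EFinP.
move=> x _; rewrite /fubini_F /=.
under eq_integral do rewrite EFinM.
rewrite ge0_integralZl ?lee_fin//.
- by rewrite -[leRHS]mule1 lee_wpmul2l// lee_fin.
- by apply/measurable_EFinP/(measurableT_comp mv); exact: measurable_fun_pair.
- by move=> y _; rewrite lee_fin.
Qed.

(* Also holds when the normalizing integral is 0 or +oo, because
   [fine +oo = 0] and division by 0 gives 0. *)
Lemma integral_normalized_le1 (f : V1 * V2 -> R) (x : V1) :
  measurable_fun setT f -> (forall z, (0 <= f z)%R) ->
  \int[m2]_y (f (x, y) / fine (\int[m2]_y' (f (x, y'))%:E))%:E <= 1.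
Proof.
move=> mf f0; set F := \int[m2]_y' (f (x, y'))%:E.
have F0 : 0 <= F by apply: integral_ge0 => y _; rewrite lee_fin.
under eq_integral do rewrite EFinM.
rewrite ge0_integralZr ?lee_fin ?invr_ge0 ?fine_ge0//.
- rewrite -/F; have [Ffin|Finf] := boolP (F \is a fin_num); last first.
    have -> : fine F = 0%R by move: Finf; case: F {F0}.
    by rewrite invr0 mule0.
  have [F00|F00] := eqVneq (fine F) 0%R; first by rewrite F00 invr0 mule0.
  by rewrite -[X in X * _]fineK// -EFinM divff.
- by apply/measurable_EFinP/(measurableT_comp mf); exact: measurable_fun_pair.
- by move=> y _; rewrite lee_fin.
Qed.

End product_integral.

Lemma integral_leb1_shift {R : realType} (g : R -> R) (c : R) :
  measurable_fun setT g -> (forall x, 0 <= g x) ->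
  (\int[@leb1 R]_x (g (x + c))%:E = \int[@leb1 R]_x (g x)%:E)%E.
Proof.
move=> mg g0.
pose phi (x : R) := x + c.
have mphi : measurable_fun setT phi by exact: measurable_funD.
transitivity (\int[pushforward (@leb1 R) phi]_x (g x)%:E)%E.
  rewrite [RHS]ge0_integral_pushforward//; first exact/measurable_EFinP.
  by move=> x _; rewrite lee_fin.
by apply: eq_measure_integral => A mA _; exact: leb1_shift.
Qed.

Lemma ln_le_subr1 {R : realType} (x : R) : 0 < x -> ln x <= x - 1.
Proof.
move=> x0; have := @le_ln1Dx R (x - 1).
rewrite addrCA subrr addr0; apply.
by rewrite ltrBrDl addrN.
Qed.

(** The quantities [m], [w] and [rho] cancel in the product of the four ratios, whose logarithm is
    the left-hand side; ln u <= u - 1 for each ratio produces the constant 4. *)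
Lemma ln_four_factors_le {R : realType} (x y a b c f p r m w rho : R) :
  0 < x -> 0 < y -> 0 < a -> 0 < b -> 0 < c -> 0 < f -> 0 < p -> 0 < r ->
  0 < m -> 0 < w -> 0 < rho ->
  ln x + ln y + ln a + ln b + ln c + ln f - ln p - ln r <=
  x * y / m + a * b * c / w + w * (m / rho) / p + f * rho / r - 4.
Proof.
move=> x0 y0 a0 b0 c0 f0 p0 r0 m0 w0 rho0.
have := ln_le_subr1 (divr_gt0 (mulr_gt0 x0 y0) m0).
have := ln_le_subr1 (divr_gt0 (mulr_gt0 (mulr_gt0 a0 b0) c0) w0).
have := ln_le_subr1 (divr_gt0 (mulr_gt0 w0 (divr_gt0 m0 rho0)) p0).
have := ln_le_subr1 (divr_gt0 (mulr_gt0 f0 rho0) r0).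
rewrite !ln_div ?lnM ?posrE ?mulr_gt0 ?invr_gt0// lnV ?posrE//; lra.
Qed.

(** * Densities of the Markov chain and the entropy inequality for the sum *)

Section markov_chain.
Context {R : realType} {d : measure_display} {T : measurableType d}.
Variables (P : probability T R) (X1 X2 Y Y' : T -> R).
Hypotheses (mX1 : measurable_fun setT X1) (mX2 : measurable_fun setT X2)
  (mY : measurable_fun setT Y) (mY' : measurable_fun setT Y').
Local Notation l1 := (@leb1 R).
Variables (f : R * R -> R) (fX fY g : R -> R).
Hypotheses (dX2Y : is_density (l1 \X l1) P (pairRV X2 Y) f)
  (dX1Y : is_density (l1 \X l1) P (pairRV X1 Y) f)
  (dX1Y' : is_density (l1 \X l1) P (pairRV X1 Y') f).
Hypotheses (dX1 : is_density l1 P X1 fX) (dX2 : is_density l1 P X2 fX)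
  (dY : is_density l1 P Y fY) (dY' : is_density l1 P Y' fY).
Hypotheses (chainY : cond_indep P X2 X1 Y)
  (chainX1 : cond_indep P (pairRV X2 Y) Y' X1).

Let density_swap (A B : T -> R) (q : R * R -> R) :
  is_density (l1 \X l1) P (pairRV A B) q ->
  is_density (l1 \X l1) P (pairRV B A) (fun z => q (z.2, z.1)).
Proof.
apply: (density_map (phi := fun z => (z.2, z.1)) (psi := fun z => (z.2, z.1))).
- exact: measure_preserving_swap.
- exact: measurable_fun_pair.
- by case.
Qed.

Let swapl := measure_preserving_prodl l1 (measure_preserving_swap l1 l1).

Let density_X2_Y_X1 :
  is_density (l1 \X l1 \X l1) P (pairRV (pairRV X2 Y) X1)
    (fun z => f z.1 * f (z.2, z.1.2) / fY z.1.2).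
Proof. exact: density_cond_indep. Qed.

Lemma density_X1_Y_X2 :
  is_density (l1 \X l1 \X l1) P (pairRV (pairRV X1 Y) X2)
    (fun z => f (z.2, z.1.2) * f z.1 / fY z.1.2).
Proof.
(* Swapping coordinates 1-2, then 2-3, then 1-2 again exchanges the first and the third. This map is
   its own inverse, so [mphi] also serves for [psi]. *)
have mp := measure_preserving_comp (measure_preserving_comp swapl
  (measure_preserving_rot l1 l1 l1)) swapl.
have [mphi _] := mp.
have := density_map (psi := fun z => ((z.2, z.1.2), z.1.1)) mp mphi _
  density_X2_Y_X1.
have -> : (fun z : R * R * R => f (z.2, z.1.2) * f z.1 / fY z.1.2) =
   (fun z => f z.1 * f (z.2, z.1.2) / fY z.1.2) \o
     (fun z => ((z.2, z.1.2), z.1.1)).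
  by apply/funext => -[[x y] z].
by apply; case=> [[]].
Qed.

Lemma density_X1_Y_Y' :
  is_density (l1 \X l1 \X l1) P (pairRV (pairRV X1 Y) Y')
    (fun z => f z.1 * f (z.1.1, z.2) / fX z.1.1).
Proof.
(* [density_cond_indep] puts the conditioning variable in the middle: the density is found for (Y,
   X1, Y'), then the first two coordinates are swapped. *)
have dYX1Y' := density_cond_indep mY mY' mX1 (density_swap dX1Y)
  (density_swap dX1Y') dX1 (cond_indep_snd chainX1).
have [mphi _] := swapl.
have := density_map (psi := fun z => ((z.1.2, z.1.1), z.2)) swapl mphi _ dYX1Y'.
have -> : (fun z : R * R * R => f z.1 * f (z.1.1, z.2) / fX z.1.1) =
   (fun z => f (z.1.2, z.1.1) * f (z.1.2, z.2) / fX z.1.2) \o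
     (fun z => ((z.1.2, z.1.1), z.2)).
  by apply/funext => -[[x y] z].
by apply; case=> [[]].
Qed.

Let S t := X2 t + Y' t.
Let a t := X2 t + Y t.
Let b t := X1 t + Y t.

(** The density p of the chain, with [z] read as (((x2, y), x1), y'). *)
Let chain_density (z : R * R * R * R) :=
  f z.1.1 * f (z.1.2, z.1.1.2) / fY z.1.1.2 * f (z.1.2, z.2) / fX z.1.2.

Let density_chain :
  is_density (l1 \X l1 \X l1 \X l1) P
    (pairRV (pairRV (pairRV X2 Y) X1) Y') chain_density.
Proof.
apply: (density_cond_indep _ _ _ density_X2_Y_X1 (density_swap dX1Y') dX1)
  => //.
exact: measurable_fun_pair.
Qed.

(* The unimodular change of coordinates
   (x2, y, x1, y') |-> (x2 + y, x1 + y, x2 + y', x2) is read backwards here. *)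
Let sum_coordinates_inv (z : R * R * R * R) : R * R * R * R :=
  let y := z.1.1.1 - z.2 in (((z.2, y), z.1.1.2 - y), z.1.2 - z.2).

Let density_sum_coordinates :
  is_density (l1 \X l1 \X l1 \X l1) P
    (pairRV (pairRV (pairRV a b) S) X2) (chain_density \o sum_coordinates_inv).
Proof.
(* The shears [s1], [s2], [s3] add x2 to y', y to x1 and x2 to y; in this order each summand still
   has its original value when it is added. The exchanges [s4], [s5], [s6] then carry x2 to the last
   place. *)
have s1 := measure_preserving_shear (l1 \X l1 \X l1)
  (h := fun u => u.1.1) (measurableT_comp measurable_fst measurable_fst).
have s2 := measure_preserving_prodl l1
  (measure_preserving_shear (l1 \X l1) (h := snd) measurable_snd).
have s3 := measure_preserving_prodl l1 (measure_preserving_prodl l1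
  (measure_preserving_shear l1 (h := id) (@measurable_id _ _ _))).
have s4 := measure_preserving_prodl l1 swapl.
have s5 := measure_preserving_prodl l1 (measure_preserving_rot l1 l1 l1).
have s6 := measure_preserving_rot (l1 \X l1) l1 l1.
have mp := measure_preserving_comp (measure_preserving_comp
  (measure_preserving_comp (measure_preserving_comp
  (measure_preserving_comp s1 s2) s3) s4) s5) s6.
have minv : measurable_fun setT sum_coordinates_inv.
  have m1 : measurable_fun [set: R * R * R * R] (fun z => z.1.1.1 - z.2).
    apply: measurable_funB => //.
    by do 2 (apply: measurableT_comp => //).
  apply: measurable_fun_pair; last first.
    by apply: measurable_funB => //; exact: measurableT_comp.
  apply: measurable_fun_pair; first exact: measurable_fun_pair.
  apply: measurable_funB => //.
  by do 2 (apply: measurableT_comp => //).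
have := density_map (psi := sum_coordinates_inv) mp minv _ density_chain.
have -> : pairRV (pairRV (pairRV a b) S) X2 =
  (fun z : R * R * R * R =>
    (((z.1.1.2 + z.1.1.1, z.1.2 + z.1.1.2), z.2 + z.1.1.1), z.1.1.1)) \o
  pairRV (pairRV (pairRV X2 Y) X1) Y'.
  by apply/funext => t; rewrite /pairRV /a /b /S /= [X2 t + Y t]addrC
    [X2 t + Y' t]addrC.
by apply; move=> [[[x2 y] x1] y']; rewrite /sum_coordinates_inv/= !addrK.
Qed.

Let w := fun u => fine (\int[l1]_x
  ((chain_density \o sum_coordinates_inv) (u, x))%:E)%E.

Let density_abS :
  is_density (l1 \X l1 \X l1) P (pairRV (pairRV a b) S) w.
Proof. exact: density_fst density_sum_coordinates. Qed.

Let density_S_X2 : exists m, is_density (l1 \X l1) P (pairRV S X2) m.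
Proof.
(* The block (a, b) is moved to the end, as one coordinate, to be integrated out. *)
have s1 := measure_preserving_prodl l1 (measure_preserving_swap (l1 \X l1) l1).
have s2 := measure_preserving_rot l1 (l1 \X l1) l1.
have mp := measure_preserving_comp s1 s2.
pose psi (z : R * R * (R * R)) := ((z.2, z.1.1), z.1.2).
have mpsi : measurable_fun setT psi.
  apply: measurable_fun_pair; last exact: measurableT_comp.
  by apply: measurable_fun_pair => //; exact: measurableT_comp.
have dSX2 := density_map (psi := psi) mp mpsi
  (fun z => let: (((a, b), s), x) := z in erefl) density_sum_coordinates.
eexists.
exact: (density_fst (A := pairRV S X2) (B := pairRV a b) dSX2).
Qed.

(** The random variable is the logarithm of the ratio in the overview with p written out: f(X1, Y)
    cancels against a factor of p, and the denominators of p contribute ln fX(X1) and ln fY(Y). *)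
Lemma entropy_sum_le (r : R * R * R -> R) (v : R) :
  is_density l1 P a g -> is_density l1 P b g ->
  is_density l1 P (fun t => X1 t + Y' t) g ->
  is_density (l1 \X l1 \X l1) P (pairRV (pairRV X1 Y) S) r ->
  has_expectation P (fun t => ln (fX (X2 t)) + ln (fY (Y' t)) + ln (g (a t)) +
    ln (g (b t)) + ln (g (X1 t + Y' t)) + ln (fX (X1 t)) + ln (fY (Y t))
    - ln (f (X2 t, Y t)) - ln (f (X1 t, Y' t))
    - ln (r ((X1 t, Y t), S t))) v ->
  v <= 0.
Proof.
move=> dga dgb dgc dr Lv.
have mS : measurable_fun setT S by exact: measurable_funD.
have ma : measurable_fun setT a by exact: measurable_funD.
have mb : measurable_fun setT b by exact: measurable_funD.
have mc : measurable_fun setT (fun t => X1 t + Y' t) by exact: measurable_funD.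
have mSX2 : measurable_fun setT (pairRV S X2) by exact: measurable_fun_pair.
have mX2S : measurable_fun setT (pairRV X2 S) by exact: measurable_fun_pair.
have mX2Y : measurable_fun setT (pairRV X2 Y) by exact: measurable_fun_pair.
have mX1Y : measurable_fun setT (pairRV X1 Y) by exact: measurable_fun_pair.
have mX1Y' : measurable_fun setT (pairRV X1 Y') by exact: measurable_fun_pair.
have mX1YS : measurable_fun setT (pairRV (pairRV X1 Y) S).
  exact: measurable_fun_pair.
have mabS : measurable_fun setT (pairRV (pairRV a b) S).
  by apply: measurable_fun_pair => //; exact: measurable_fun_pair.
have mabSX2 : measurable_fun setT (pairRV (pairRV (pairRV a b) S) X2).
  exact: measurable_fun_pair.
have [m dm] := density_S_X2.
pose rho s := fine (\int[l1]_x (m (s, x))%:E)%E.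
have drho : is_density l1 P S rho := density_fst dm.
have [mf [f0 _]] := dX1Y; have [mfX [fX0 _]] := dX1; have [mfY [fY0 _]] := dY.
have [mg [g0 _]] := dga; have [mm [m0 _]] := dm; have [mrho [rho0 _]] := drho.
have [mw [w0 _]] := density_abS; have [mr [r0 _]] := dr.
(* The numerator would be the density of (X2, S) if X2 and Y' were independent: for fixed x2 it is a
   translate of [fY] in s. *)
have e1 : expectation_le P
    (fun t => fX (X2 t) * fY (S t - X2 t) / m (S t, X2 t)) 1.
  apply: (expectation_le_ratio
    (q := fun z : R * R => fX z.1 * fY (z.2 - z.1)) mX2S (density_swap dm)).
  - apply: measurable_funM; first exact: measurableT_comp.
    by apply: (measurableT_comp mfY); exact: measurable_funB.
  - by move=> z; rewrite mulr_ge0.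
  - apply: (integral_prod_le1 (v := fun z : R * R => fY (z.2 - z.1))) => //.
    + by apply: (measurableT_comp mfY); exact: measurable_funB.
    + by rewrite (integral_density dX1).
    + by move=> x /=; rewrite integral_leb1_shift// (integral_density dY).
(* X1 + Y' is S + (b - a), so for fixed (a, b) the last factor is a translate of [g] in s. *)
have e2 : expectation_le P
    (fun t => g (a t) * g (b t) * g (S t + (b t - a t)) / w (a t, b t, S t)) 1.
  have mv : measurable_fun [set: R * R * R]
      (fun z => g (z.2 + (z.1.2 - z.1.1))).
    apply: (measurableT_comp mg); apply: measurable_funD => //.
    by apply: measurable_funB; exact: measurableT_comp.
  have mu : measurable_fun [set: R * R] (fun z => g z.1 * g z.2).
    by apply: measurable_funM; exact: measurableT_comp.
  apply: (expectation_le_ratio (q := fun z : R * R * R => g z.1.1 * g z.1.2 *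
    g (z.2 + (z.1.2 - z.1.1))) mabS density_abS).
  - by apply: measurable_funM => //; exact: (measurableT_comp mu).
  - by move=> z; rewrite !mulr_ge0.
  - apply: (integral_prod_le1 (u := fun z : R * R => g z.1 * g z.2)
      (v := fun z : R * R * R => g (z.2 + (z.1.2 - z.1.1)))) => //.
    + by move=> z; rewrite mulr_ge0.
    + apply: (integral_prod_le1 (v := fun z : R * R => g z.2)) => //.
      * exact: measurableT_comp.
      * by rewrite (integral_density dga).
      * by move=> x; rewrite (integral_density dga).
    + by move=> x /=; rewrite integral_leb1_shift// (integral_density dga).
(* Here m / rho is the conditional density of X2 given S, so the numerator makes X2 and (a, b)
   conditionally independent given S. *)
have e3 : expectation_le P (fun t => w (a t, b t, S t) *
    (m (S t, X2 t) / rho (S t)) /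
    (chain_density \o sum_coordinates_inv) (a t, b t, S t, X2 t)) 1.
  have mv : measurable_fun [set: R * R * R * R]
      (fun z => m (z.1.2, z.2) / rho z.1.2).
    have m2 : measurable_fun [set: R * R * R * R] (fun z => z.1.2).
      exact: measurableT_comp.
    apply: measurable_funM.
      by apply: (measurableT_comp mm); exact: measurable_fun_pair.
    by apply: (measurableT_comp (@measurable_invr R)); exact: measurableT_comp.
  apply: (expectation_le_ratio
    (q := fun z : R * R * R * R => w z.1 * (m (z.1.2, z.2) / rho z.1.2))
    mabSX2 density_sum_coordinates).
  - by apply: measurable_funM => //; exact: measurableT_comp.
  - by move=> z; rewrite mulr_ge0// divr_ge0.
  - apply: (integral_prod_le1
      (v := fun z : R * R * R * R => m (z.1.2, z.2) / rho z.1.2)) => //.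
    + by move=> z; rewrite divr_ge0.
    + by rewrite (integral_density density_abS).
    + by move=> u; exact: integral_normalized_le1.
(* The numerator makes (X1, Y) and S independent. *)
have e4 : expectation_le P
    (fun t => f (X1 t, Y t) * rho (S t) / r (X1 t, Y t, S t)) 1.
  apply: (expectation_le_ratio
    (q := fun z : R * R * R => f z.1 * rho z.2) mX1YS dr).
  - by apply: measurable_funM; exact: measurableT_comp.
  - by move=> z; rewrite mulr_ge0.
  - apply: (integral_prod_le1 (v := fun z : R * R * R => rho z.2)) => //.
    + exact: measurableT_comp.
    + by rewrite (integral_density dX1Y).
    + by move=> u /=; rewrite (integral_density drho).
(* Four expectations of at most 1 add up to the constant 4 of [ln_four_factors_le], which applies
   where all densities are positive, hence almost surely. *)
apply: has_expectation_le0 Lv (expectation_leD (expectation_leD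
  (expectation_leD e1 e2) e3) e4) _.
near=> t.
have fX2Y : 0 < f (X2 t, Y t) by near: t; exact: density_gt0 dX2Y.
have fX1Y : 0 < f (X1 t, Y t) by near: t; exact: density_gt0 dX1Y.
have fX1Y' : 0 < f (X1 t, Y' t) by near: t; exact: density_gt0 dX1Y'.
have fX1 : 0 < fX (X1 t) by near: t; exact: density_gt0 dX1.
have fX2 : 0 < fX (X2 t) by near: t; exact: density_gt0 dX2.
have fY1 : 0 < fY (Y t) by near: t; exact: density_gt0 dY.
have fY2 : 0 < fY (Y' t) by near: t; exact: density_gt0 dY'.
have ga : 0 < g (a t) by near: t; exact: density_gt0 dga.
have gb : 0 < g (b t) by near: t; exact: density_gt0 dgb.
have gc : 0 < g (X1 t + Y' t) by near: t; exact: density_gt0 dgc.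
have mt : 0 < m (S t, X2 t) by near: t; exact: density_gt0 dm.
have wt : 0 < w (a t, b t, S t) by near: t; exact: density_gt0 density_abS.
have rhot : 0 < rho (S t) by near: t; exact: density_gt0 drho.
have rt : 0 < r (X1 t, Y t, S t) by near: t; exact: density_gt0 dr.
(* Back from the coordinates (a, b, S, X2) to the original variables. *)
have -> : S t - X2 t = Y' t by rewrite /S addrC addKr.
have -> : S t + (b t - a t) = X1 t + Y' t by rewrite /S /a /b; ring.
have -> : (chain_density \o sum_coordinates_inv) (a t, b t, S t, X2 t) =
    f (X2 t, Y t) * f (X1 t, Y t) / fY (Y t) * f (X1 t, Y' t) / fX (X1 t).
  rewrite /chain_density /sum_coordinates_inv /=.
  have -> : a t - X2 t = Y t by rewrite /a addrC addKr.
  have -> : b t - Y t = X1 t by rewrite /b addrK.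
  by have -> : S t - X2 t = Y' t by rewrite /S addrC addKr.
have p0 : 0 < f (X2 t, Y t) * f (X1 t, Y t) / fY (Y t) * f (X1 t, Y' t) /
    fX (X1 t).
  by rewrite !(divr_gt0, mulr_gt0).
have := ln_four_factors_le fX2 fY2 ga gb gc fX1Y p0 rt mt wt rhot.
rewrite [ln (_ / fX _)]ln_div ?[ln (_ * f (_, Y' t))]lnM ?ln_div ?lnM ?posrE
  ?divr_gt0 ?mulr_gt0 ?invr_gt0//; lra.
Unshelve. all: by end_near.
Qed.

End markov_chain.

(** Lets a log-density evaluated at any copy of X, Y, (X, Y) or X + Y contribute the entropy of the
    original variable. *)
Lemma has_expectation_entropy {d dV : measure_display} {T : measurableType d}
    {V : measurableType dV} {R : realType} (P : probability T R)
    (mu : {measure set V -> \bar R}) (Z Z' : T -> V) (f : V -> R) :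
  measurable_fun setT Z' -> same_law P Z' Z ->
  has_entropy mu P Z -> is_density mu P Z f ->
  has_expectation P (fun t => ln (f (Z' t))) (- dentropy mu P Z).
Proof.
move=> mZ' ZZ' hZ; rewrite -(is_density_same_law mu ZZ') => fd.
have hZ' : has_entropy mu P Z' by apply: has_entropy_same_law hZ => A /ZZ'.
have [lni lnE] := has_entropy_density mZ' hZ' fd.
by split=> //; rewrite -(dentropy_same_law mu ZZ') lnE opprK.
Qed.

(** * The three entropy inequalities *)

Theorem mainTheorem14 (R : realType) (d : measure_display)
  (T : measurableType d) (P : probability T R)
  (X Y X1 X2 Y' : T -> R) (K : R) :
  measurable_fun setT X -> measurable_fun setT Y ->
  measurable_fun setT X1 -> measurable_fun setT X2 -> measurable_fun setT Y' ->
  1 <= K ->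
  (* all differential entropies appearing exist and are finite *)
  has_entropy (@leb1 R) P X -> has_entropy (@leb1 R) P Y ->
  has_entropy (@leb2 R) P (pairRV X Y) ->
  has_entropy (@leb1 R) P (X \+ Y) ->
  has_entropy (@leb3 R) P (pairRV (pairRV X1 Y) X2) ->
  has_entropy (@leb3 R) P (pairRV (pairRV X1 Y) Y') ->
  has_entropy (@leb3 R) P (pairRV (pairRV X1 Y) (X2 \+ Y')) ->
  (* I(X;Y) <= log K *)
  dentropy (@leb2 R) P (pairRV X Y) >=
    dentropy (@leb1 R) P X + dentropy (@leb1 R) P Y - ln K ->
  (* h(X+Y) <= h(X)/2 + h(Y)/2 + log K *)
  dentropy (@leb1 R) P (X \+ Y) <=
    dentropy (@leb1 R) P X / 2 + dentropy (@leb1 R) P Y / 2 + ln K ->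
  (* Markov chain X2 - Y - X1 - Y' *)
  cond_indep P X2 X1 Y ->
  cond_indep P (pairRV X2 Y) Y' X1 ->
  (* (X2,Y), (X1,Y), (X1,Y') all have the law of (X,Y) *)
  (forall A : set (R * R), measurable A ->
     P (pairRV X2 Y @^-1` A) = P (pairRV X Y @^-1` A)) ->
  (forall A : set (R * R), measurable A ->
     P (pairRV X1 Y @^-1` A) = P (pairRV X Y @^-1` A)) ->
  (forall A : set (R * R), measurable A ->
     P (pairRV X1 Y' @^-1` A) = P (pairRV X Y @^-1` A)) ->
  (* h(X2 | X1, Y) >= h(X) - log K *)
  dentropy (@leb3 R) P (pairRV (pairRV X1 Y) X2)
    - dentropy (@leb2 R) P (pairRV X1 Y) >= dentropy (@leb1 R) P X - ln K /\
  (* h(Y' | X1, Y) >= h(Y) - log K *)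
  dentropy (@leb3 R) P (pairRV (pairRV X1 Y) Y')
    - dentropy (@leb2 R) P (pairRV X1 Y) >= dentropy (@leb1 R) P Y - ln K /\
  (* h(X2 + Y' | X1, Y) <= h(X)/2 + h(Y)/2 + 7 log K *)
  dentropy (@leb3 R) P (pairRV (pairRV X1 Y) (X2 \+ Y'))
    - dentropy (@leb2 R) P (pairRV X1 Y) <=
    dentropy (@leb1 R) P X / 2 + dentropy (@leb1 R) P Y / 2 + 7 * ln K.
Proof.
move=> mX mY mX1 mX2 mY' K1 hX hY hXY hS h3 h3' h3S Ixy hsum ci1 ci2.
move=> law2 law1 law1'.
have [f [dXY _]] := hXY; have [fX [dX _]] := hX; have [fY [dY _]] := hY.
have [g [dg _]] := hS; have [r [dr _]] := h3S.
have madd : measurable_fun [set: R * R] (fun z => z.1 + z.2).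
  exact: measurable_funD.
have lX1 : same_law P X1 X := same_law_comp measurable_fst law1.
have lX2 : same_law P X2 X := same_law_comp measurable_fst law2.
have lY' : same_law P Y' Y.
  move=> A mA; transitivity (P (Y @^-1` A)) => //.
  exact: (same_law_comp measurable_snd law1' mA).
have la : same_law P (fun t => X2 t + Y t) (X \+ Y) := same_law_comp madd law2.
have lb : same_law P (fun t => X1 t + Y t) (X \+ Y) := same_law_comp madd law1.
have lc : same_law P (fun t => X1 t + Y' t) (X \+ Y).
  exact: (same_law_comp madd law1').
have to_leb2 := @leb2E R; have to_leb3 := @leb3E R.
have dens2 (Z : T -> R * R) : same_law P Z (pairRV X Y) ->
    is_density (@leb1 R \X @leb1 R) P Z f.
  move=> lZ; apply: density_eq_measure to_leb2 _.
  by rewrite (is_density_same_law _ lZ).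
have dens1 (Z Z' : T -> R) q : same_law P Z Z' ->
    is_density (@leb1 R) P Z' q -> is_density (@leb1 R) P Z q.
  by move=> lZ; rewrite (is_density_same_law _ lZ).
have dX2Y := dens2 _ law2; have dX1Y := dens2 _ law1.
have dX1Y' := dens2 _ law1'.
have dX1 := dens1 _ _ _ lX1 dX; have dX2 := dens1 _ _ _ lX2 dX.
have dY' := dens1 _ _ _ lY' dY.
have mpair (A B : T -> R) : measurable_fun setT A -> measurable_fun setT B ->
  measurable_fun setT (pairRV A B) by exact: measurable_fun_pair.
have Ef Z mZ lZ := has_expectation_entropy (Z' := Z) mZ lZ hXY dXY.
have EX Z mZ lZ := has_expectation_entropy (Z' := Z) mZ lZ hX dX.
have EY Z mZ lZ := has_expectation_entropy (Z' := Z) mZ lZ hY dY.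
have Eg Z mZ lZ := has_expectation_entropy (Z' := Z) mZ lZ hS dg.
have EX2Y := Ef _ (mpair _ _ mX2 mY) law2.
have EX1Y := Ef _ (mpair _ _ mX1 mY) law1.
have EX1Y' := Ef _ (mpair _ _ mX1 mY') law1'.
have fgt0 (Z : T -> R * R) : measurable_fun setT Z ->
    same_law P Z (pairRV X Y) -> {ae P, forall t, 0 < f (Z t)}.
  by move=> mZ /dens2; exact: density_gt0.
have E3 (Z : T -> R * R * R) q : measurable_fun setT Z ->
    has_entropy (@leb3 R) P Z ->
    is_density (@leb1 R \X @leb1 R \X @leb1 R) P Z q ->
    has_expectation P (fun t => ln (q (Z t))) (- dentropy (@leb3 R) P Z).
  move=> mZ hZ dq; apply: has_expectation_entropy => //.
  by apply: density_eq_measure dq => A mA; exact/esym/to_leb3.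
(* h(X1, Y) becomes h(X, Y) in all three claims. *)
rewrite (dentropy_same_law _ law1).
(* Nonnegativity of ln K absorbs the difference between the constants 6 and 7. *)
have lnK := ln_ge0 K1.
split; [|split].
- have dX1YX2 := density_X1_Y_X2 mX1 mX2 mY dX2Y dX1Y dY ci1.
  have mX1YX2 : measurable_fun setT (pairRV (pairRV X1 Y) X2).
    by apply: measurable_fun_pair => //; exact: mpair.
  (* Expectation of the log-density gives h(X1, Y, X2) = 2h(X, Y) - h(Y), hence h(X2 | X1, Y) = h(X,
     Y) - h(Y). *)
  have := has_expectation_ae_unique (E3 _ _ mX1YX2 h3 dX1YX2)
    (has_expectationB (has_expectationD EX2Y EX1Y)
      (EY _ mY (fun _ _ => erefl))).
  suff ae : {ae P, forall t, ln (f (X2 t, Y t) * f (X1 t, Y t) / fY (Y t)) =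
      ln (f (X2 t, Y t)) + ln (f (X1 t, Y t)) - ln (fY (Y t))}.
    by move=> /(_ ae) hE; lra.
  have f2 := fgt0 _ (mpair _ _ mX2 mY) law2.
  have f1 := fgt0 _ (mpair _ _ mX1 mY) law1.
  have fy := density_gt0 mY dY.
  apply: filterS3 f2 f1 fy => t f2 f1 fy.
  by rewrite ln_div ?lnM ?posrE ?mulr_gt0.
- have dX1YY' := density_X1_Y_Y' mX1 mY mY' dX1Y dX1Y' dX1 ci2.
  have mX1YY' : measurable_fun setT (pairRV (pairRV X1 Y) Y').
    by apply: measurable_fun_pair => //; exact: mpair.
  (* Likewise h(X1, Y, Y') = 2h(X, Y) - h(X). *)
  have := has_expectation_ae_unique (E3 _ _ mX1YY' h3' dX1YY')
    (has_expectationB (has_expectationD EX1Y EX1Y') (EX _ mX1 lX1)).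
  suff ae : {ae P, forall t, ln (f (X1 t, Y t) * f (X1 t, Y' t) / fX (X1 t)) =
      ln (f (X1 t, Y t)) + ln (f (X1 t, Y' t)) - ln (fX (X1 t))}.
    by move=> /(_ ae) hE; lra.
  have f1 := fgt0 _ (mpair _ _ mX1 mY) law1.
  have f2 := fgt0 _ (mpair _ _ mX1 mY') law1'.
  have fx := density_gt0 mX1 dX1.
  apply: filterS3 f1 f2 fx => t f1 f2 fx.
  by rewrite ln_div ?lnM ?posrE ?mulr_gt0.
- have mX1YS : measurable_fun setT (pairRV (pairRV X1 Y) (X2 \+ Y')).
    apply: measurable_fun_pair; first exact: mpair.
    exact: measurable_funD.
  have dr' := density_eq_measure to_leb3 dr.
  have Er := has_expectation_entropy mX1YS (fun _ _ => erefl) h3S dr.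
  have Ea := Eg _ (measurable_funD mX2 mY) la.
  have Eb := Eg _ (measurable_funD mX1 mY) lb.
  have Ec := Eg _ (measurable_funD mX1 mY') lc.
  have EL := has_expectationB (has_expectationB (has_expectationB
    (has_expectationD (has_expectationD (has_expectationD (has_expectationD
    (has_expectationD (has_expectationD (EX _ mX2 lX2) (EY _ mY' lY'))
    Ea) Eb) Ec) (EX _ mX1 lX1)) (EY _ mY (fun _ _ => erefl))) EX2Y) EX1Y') Er.
  (* This reads h(X1, Y, S) <= 2h(X) + 2h(Y) + 3h(X+Y) - 2h(X, Y). After subtracting h(X, Y), the
     bounds on h(X+Y) and h(X, Y) are each used three times and cost 3 ln K each. *)
  have := entropy_sum_le mX1 mX2 mY mY' dX2Y dX1Y dX1Y' dX1 dX2 dY dY' ci1 ci2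
    (dens1 _ _ _ la dg) (dens1 _ _ _ lb dg) (dens1 _ _ _ lc dg) dr' EL.
  lra.
Qed.
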